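(* For every integer $q\ge2$ and every $n$, a code $C\subseteq\Sigma_q^n$ is detecting for the radius-one limited permutation channel if and only if $C$ is an independent set in the graph $G_n^{(q)}$. Hence $D_q(n)=\alpha(G_n^{(q)})$. For even $n$, $$\alpha\bigl(G_n^{(q)}\bigr)\le\binom{q+1}{2}^{n/2},$$ and asymptotically $$R_{\mathrm{det},q}\le\frac12\log_q\binom{q+1}{2}.$$
   Context: $\Sigma_q=\{0,1,\dots,q-1\}$. For $c=c_1\cdots c_n\in\Sigma_q^n$, $B(c)$ is the set of all words $z=z_1\cdots z_n$ with $z_i=c_{\pi(i)}$ for some permutation $\pi$ of $\{1,\dots,n\}$ satisfying $|\pi(i)-i|\le 1$ for all $i$; equivalently, all words obtained from $c$ by swapping the symbols in any set of pairwise disjoint pairs of adjacent positions. A code $C\subseteq\Sigma_q^n$ is detecting if $B(c)\cap C=\{c\}$ for every $c\in C$. $D_q(n)$ is the maximum size of a detecting code in $\Sigma_q^n$, and $R_{\mathrm{det},q}=\limsup_{n\to\infty}\frac1n\log_q D_q(n)$. $G_n^{(q)}$ is the (undirected) graph on vertex set $\Sigma_q^n$ in which two distinct words $u,v$ are adjacent if $v\in B(u)$ (this relation is symmetric). $\alpha(G)$ is the independence number of $G$. *)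

(* Defs.v *)
From HB Require Import structures.
From mathcomp Require Import all_boot all_order all_algebra all_fingroup.
From mathcomp Require Import all_classical all_reals all_analysis.
Set Implicit Arguments.
Unset Strict Implicit.
Unset Printing Implicit Defensive.
Import Order.TTheory GRing.Theory Num.Theory.

Record sgraph := SGraph {
  vertex :> finType;
  adj : rel vertex;
  adj_sym : symmetric adj;
  adj_irrefl : irreflexive adj }.

Definition independent (G : sgraph) (S : {set G}) : bool :=
  [forall u in S, forall v in S, ~~ adj u v].

Definition alpha (G : sgraph) : nat :=
  \max_(S : {set G} | independent S) #|S|.

(* Positions run over 0, ..., n - 1. *)
Definition word (q n : nat) : finType := n.-tuple 'I_q.

Definition limited_perm (n : nat) (pi : 'S_n) : bool :=
  [forall i : 'I_n, `|(pi i)%:Z - i%:Z| <= 1]%R.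

Definition B (q n : nat) (c : word q n) : {set word q n} :=
  [set z : word q n | [exists pi : 'S_n,
     limited_perm pi && [forall i, tnth z i == tnth c (pi i)]]].

Definition detecting (q n : nat) (C : {set word q n}) : bool :=
  [forall c in C, B c :&: C == [set c]].

(* The empty code is detecting, so the maximum is attained. *)
Definition D (q n : nat) : nat :=
  \max_(C : {set word q n} | detecting C) #|C|.

Definition swap_adj (q n : nat) : rel (word q n) :=
  fun u v => (u != v) && (v \in B u).

Lemma B_sym (q n : nat) (u v : word q n) : v \in B u -> u \in B v.
Proof.
rewrite !inE => /existsP[pi /andP[/forallP lim_pi /forallP Ev]].
apply/existsP; exists (pi^-1)%g; apply/andP; split; apply/forallP => i.
  by have := lim_pi (pi^-1 i)%g; rewrite permKV distrC.
by have := Ev (pi^-1 i)%g; rewrite permKV eq_sym.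
Qed.

Lemma swap_adj_sym (q n : nat) : symmetric (@swap_adj q n).
Proof.
move=> u v; rewrite /swap_adj eq_sym; congr (_ && _).
by apply/idP/idP; apply: B_sym.
Qed.

Lemma swap_adj_irrefl (q n : nat) : irreflexive (@swap_adj q n).
Proof. by move=> u; rewrite /swap_adj eqxx. Qed.

Definition swap_graph (q n : nat) : sgraph :=
  SGraph (@swap_adj_sym q n) (@swap_adj_irrefl q n).

Definition logb (R : realType) (q : nat) (x : R) : R :=
  (ln x / ln q%:R)%R.

(* The limit superior is taken in the extended reals, where it always exists;
   the term n = 0, in which 0^-1 = 0, does not affect it. *)
Definition Rdet (R : realType) (q : nat) : \bar R :=
  limn_esup (fun n : nat => (n%:R^-1 * logb q ((D q n)%:R : R))%:E)%R.

(* Main.v *)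
Require Import Defs.
From mathcomp Require Import all_boot all_order all_algebra all_fingroup.
From mathcomp Require Import all_classical all_reals all_analysis.
From mathcomp Require Import zify lra.

(** Group the positions into the pairs {0,1}, {2,3}, ..., the last position
    being alone when n is odd, and record for each pair the multiset of its two
    symbols.  Two words with the same record differ by swaps inside these
    disjoint pairs, so the record is injective on an independent set.  It takes
    at most 'C(q+1, 2) ^ (uphalf n) values, a bound valid for both parities,
    from which the asymptotic rate follows without embedding odd lengths into
    even ones. *)

Set Implicit Arguments.
Unset Strict Implicit.
Unset Printing Implicit Defensive.
Import Order.TTheory GRing.Theory Num.Theory.

Lemma id_in_B (q n : nat) (c : word q n) : c \in B c.
Proof.
rewrite inE; apply/existsP; exists 1%g; apply/andP; split; apply/forallP => i.
  by rewrite perm1 subrr normr0.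
by rewrite perm1.
Qed.

(** Since [c] always lies in [B c], the condition on [B c :&: C] only forbids a second codeword in
    [B c], which would be a neighbour of [c]. *)
Lemma detectingE (q n : nat) (C : {set word q n}) :
  detecting C = independent (C : {set swap_graph q n}).
Proof.
apply/forall_inP/forall_inP => [dC u uC | iC c cC].
  apply/forall_inP => v vC; apply/negP => /andP[uv vB].
  have: v \in B u :&: C by rewrite inE vB.
  by rewrite (eqP (dC u uC)) inE eq_sym (negPf uv).
apply/eqP/setP => v; rewrite !inE -/(v \in B c).
apply/andP/eqP => [[vB vC] | ->]; last first.
  by have := id_in_B c; rewrite inE.
apply/eqP; apply: contraTT vC => vc; apply/negP => vC.
have /forall_inP/(_ v vC) := iC c cC; apply/negP; rewrite negbK /= /swap_adj.
by rewrite eq_sym vc /= inE.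
Qed.

Lemma D_eq_alpha (q n : nat) : D q n = alpha (swap_graph q n).
Proof. by apply: eq_bigl => C; rewrite detectingE. Qed.

(* When the neighbour is out of range, which only happens to the last position
   of an odd length, [insubd] returns [i] itself. *)
Definition partner (n : nat) (i : 'I_n) : 'I_n :=
  insubd i (if odd i then i.-1 else i.+1).

Lemma val_partner (n : nat) (i : 'I_n) :
  partner i = (if odd i then i.-1 else if i.+1 < n then i.+1 else i) :> nat.
Proof.
rewrite /partner val_insubd; case: (odd i) => //.
by rewrite (leq_ltn_trans (leq_pred i)) ?ltn_ord.
Qed.

Lemma partnerK (n : nat) : involutive (@partner n).
Proof.
move=> i; apply: val_inj; rewrite /= !val_partner.
have := ltn_ord i; do !case: ifP; lia.
Qed.

Lemma partner_near (n : nat) (i : 'I_n) :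
  (`|(partner i)%:Z - i%:Z| <= 1)%R.
Proof. by rewrite val_partner; do 2?case: ifP; lia. Qed.

Lemma perm_eq_pairP (T : eqType) (a b c d : T) :
  perm_eq [:: a; b] [:: c; d] -> a = c /\ b = d \/ a = d /\ b = c.
Proof.
move=> p; have: a \in [:: c; d] by rewrite -(perm_mem p) mem_head.
rewrite !inE => /orP[]/eqP eq_a; [left|right]; split=> //.
  by move: p; rewrite eq_a perm_cons => /perm_mem/(_ b); rewrite !inE eqxx => /esym/eqP.
move: p; rewrite eq_a perm_sym (perm_catC [:: c] [:: d]) perm_cons.
by move/perm_mem/(_ c); rewrite !inE eqxx => /esym/eqP.
Qed.

Lemma partner_swaps_in_B (q n : nat) (u v : word q n) :
  (forall i, perm_eq [:: tnth u i; tnth u (partner i)]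
                     [:: tnth v i; tnth v (partner i)]) ->
  v \in B u.
Proof.
move=> uv.
(* Swap a pair exactly when the words disagree on it. If they disagree at [i], the symbols match
   crosswise, so they disagree at [partner i] too; hence [s] is an involution. *)
pose s i := if tnth v i == tnth u i then i else partner i.
have sK : involutive s.
  move=> i; rewrite /s; case: (eqVneq (tnth v i)) => [-> | vi]; first by rewrite eqxx.
  have [[e _]|[e1 e2]] := perm_eq_pairP (uv i); first by rewrite e eqxx in vi.
  by rewrite partnerK -e1 e2 eq_sym (negPf vi).
rewrite inE; apply/existsP; exists (perm (inv_inj sK)).
apply/andP; split; apply/forallP => i; rewrite permE /s.
  by case: ifP => _; [rewrite subrr normr0 | apply: partner_near].
case: (eqVneq (tnth v i) (tnth u i)) => [-> // | vi].
have [[e _]|[_ ->//]] := perm_eq_pairP (uv i).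
by rewrite e eqxx in vi.
Qed.

Lemma double_ltn_of_uphalf (n : nat) (k : 'I_(uphalf n)) : k.*2 < n.
Proof. by have := ltn_ord k; lia. Qed.

Definition pair_start (n : nat) (k : 'I_(uphalf n)) : 'I_n :=
  Ordinal (double_ltn_of_uphalf k).

Lemma pair_startP (n : nat) (i : 'I_n) :
  exists k, i = pair_start k \/ i = partner (pair_start k).
Proof.
have lt_half : i./2 < uphalf n by have := ltn_ord i; lia.
exists (Ordinal lt_half).
have [io|ie] := boolP (odd i); [right|left]; apply: val_inj.
  by rewrite /= val_partner /=; have := ltn_ord i; do 2?case: ifP; lia.
by rewrite /=; lia.
Qed.

(** Sorting gives a canonical form of the multiset. For odd [n] the last entry repeats the unpaired
    symbol, so it is again a sorted pair. *)
Definition pair_record (q n : nat) (c : word q n) :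
    {ffun 'I_(uphalf n) -> 2.-tuple 'I_q} :=
  [ffun k => [tuple of sort (relpre val leq)
     [tuple tnth c (pair_start k); tnth c (partner (pair_start k))]]].

Lemma pair_record_in_B (q n : nat) (u v : word q n) :
  pair_record u = pair_record v -> v \in B u.
Proof.
move=> uv; apply: partner_swaps_in_B => i.
have start k : perm_eq
    [:: tnth u (pair_start k); tnth u (partner (pair_start k))]
    [:: tnth v (pair_start k); tnth v (partner (pair_start k))].
  have /(congr1 val)/= e := congr1 (fun f : {ffun _} => f k) uv.
  rewrite !ffunE /= in e.
  apply/(perm_sortP (leT := relpre val leq)) => //.
  - by move=> a b; apply: leq_total.
  - by move=> a b c; apply: leq_trans.
  - by move=> a b /anti_leq/val_inj.
have [k [->|->]] := pair_startP i; first exact: start.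
have swap (a b : 'I_q) : perm_eq [:: a; b] [:: b; a].
  exact: permEl (perm_catC [:: a] [:: b]).
(* Seen from the second position of a pair, both lists appear reversed. *)
by rewrite partnerK; exact: perm_trans (swap _ _) (perm_trans (start k) (swap _ _)).
Qed.

Lemma alpha_le_uphalf (q n : nat) :
  0 < q -> alpha (swap_graph q n) <= 'C(q.+1, 2) ^ uphalf n.
Proof.
case: q => // q _; apply/bigmax_leqP => C indC.
rewrite -(card_in_imset (f := @pair_record q.+1 n)); last first.
  move=> u v uC vC /pair_record_in_B vB; apply/eqP.
  move/forall_inP/(_ u uC)/forall_inP/(_ v vC): indC.
  by rewrite /= /swap_adj vB andbT negbK.
(* The alphabet now has [q.+1] letters, and there are ['C(2 + q, 2)] sorted pairs over it; the power
   counts functions from pair indices to such pairs. *)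
rewrite -[q.+2]/(2 + q) -card_sorted_tuples -[X in _ ^ X]card_ord -card_ffun_on.
apply/subset_leq_card/fintype.subsetP => _ /imsetP[c _ ->]; apply/ffun_onP => k.
rewrite ffunE inE sorted_map; apply: sort_sorted => a b; exact: leq_total.
Qed.

Local Open Scope classical_set_scope.
Local Open Scope ring_scope.

(** The limit superior is an infimum of suprema over neighbourhoods of infinity, and a single tail
    bounded by [l] is one of these. *)
Lemma limn_esup_le_near (R : realType) (u : (\bar R)^nat) (l : \bar R) :
  (\forall n \near \oo, (u n <= l)%E) -> (limn_esup u <= l)%E.
Proof.
move=> [N _ Nul]; apply: (@le_trans _ _ (ereal_sup (u @` [set n | (N <= n)%N]))).
  by apply: ereal_inf_lbound; exists [set n | (N <= n)%N] => //; exists N.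
by apply: ge_ereal_sup => _ [n Nn <-]; apply: Nul.
Qed.

Lemma logb_D_le (R : realType) (q n : nat) : (2 <= q)%N ->
  logb q ((D q n)%:R : R) <= (uphalf n)%:R * logb q ('C(q.+1, 2)%:R : R).
Proof.
move=> hq; have lnq : 0 < ln (q%:R : R) by rewrite ln_gt0 // ltr1n.
have Cgt0 : (0 < 'C(q.+1, 2))%N by rewrite bin_gt0 ltnS ltnW.
rewrite /logb mulrA ler_pM2r ?invr_gt0 // mulrC mulr_natr -lnXn ?ltr0n //.
have le_DC : (D q n <= 'C(q.+1, 2) ^ uphalf n)%N.
  by rewrite D_eq_alpha alpha_le_uphalf // ltnW.
(* At 0 the function [ln] takes the default value 0, so that case asks only for a nonnegative
   bound. *)
rewrite -natrX; case: (posnP (D q n)) => [-> | D_gt0].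
  by rewrite ln0 // ln_ge0 // ler1n expn_gt0 Cgt0.
by rewrite ler_ln ?qualifE /= ?ltr0n ?ler_nat // expn_gt0 Cgt0.
Qed.

Lemma Rdet_le (R : realType) (q : nat) : (2 <= q)%N ->
  (Rdet R q <= (2^-1 * logb q ('C(q.+1, 2)%:R : R))%:E)%E.
Proof.
move=> hq; set L := logb q _.
have L_ge0 : 0 <= L.
  rewrite /L /logb divr_ge0 // ln_ge0 // ler1n ?bin_gt0; lia.
(* Rounding up [n / 2] costs at most [L / 2] in total, hence at most [e] per symbol once
   [L <= e * n]. *)
apply/lee_addgt0Pr => e e_gt0; apply: limn_esup_le_near.
near=> n.
have n_gt0 : 0 < n%:R :> R by rewrite ltr0n; near: n; exact: nbhs_infty_gt.
have Ln : L <= e * n%:R.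
  by rewrite mulrC -ler_pdivrMr //; near: n; exact: nbhs_infty_ger.
rewrite -EFinD lee_fin mulrC ler_pdivrMr //.
apply: le_trans (logb_D_le _ n hq) _; rewrite -/L.
have half_le : (uphalf n)%:R * 2 <= n%:R + 1 :> R.
  by rewrite -natrM natr1 ler_nat; lia.
nra.
Unshelve. all: by end_near.
Qed.

Theorem proposition15 (R : realType) (q : nat) (hq : (2 <= q)%N) :
  (forall (n : nat) (C : {set word q n}),
     detecting C <-> independent (C : {set swap_graph q n}))
  /\ (forall n : nat, D q n = alpha (swap_graph q n))
  /\ (forall n : nat, ~~ odd n ->
        (alpha (swap_graph q n) <= 'C(q.+1, 2) ^ (n./2))%N)
  /\ (Rdet R q <= (2^-1 * logb q ('C(q.+1, 2)%:R : R))%:E)%E.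
Proof.
split; first by move=> n C; rewrite detectingE.
split; first exact: D_eq_alpha.
split; last exact: Rdet_le.
move=> n n_even; have := alpha_le_uphalf n (ltnW hq).
by rewrite uphalf_half (negPf n_even).
Qed.
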